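(* Let $S$ be an admissible surface in the simply isotropic space $\mathbb{I}^3$ with local parameterization $\mathbf{x}(u^1,u^2)$. Then the coefficients of the relative connection satisfy, for all $a,b,c,e\in\{1,2\}$, the Gauss equation $$\Xi_{ab,c}^e-\Xi_{ac,b}^e+\Xi_{ab}^d\Xi_{cd}^e-\Xi_{ac}^d\Xi_{bd}^e=(\rho_{ab}h_{cd}-\rho_{ac}h_{bd})g^{ed}=(h_{ab}h_{cd}-h_{ac}h_{bd})\frac{g^{ed}}{\Vert\tilde\xi\Vert^2+\xi^3}=(\Vert\tilde\xi\Vert^2+\xi^3)(\rho_{ab}\rho_{cd}-\rho_{ac}\rho_{bd})g^{ed}$$ and the Codazzi-Mainardi equation $$\rho_{ab,c}-\rho_{ac,b}+\Xi_{ab}^d\rho_{cd}-\Xi_{ac}^d\rho_{bd}=0 .$$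
   Context: The simply isotropic space $\mathbb{I}^3$ is $\mathbb{R}^3$ with the degenerate inner product $\langle \mathbf u,\mathbf v\rangle_z=u^1v^1+u^2v^2$. A plane is isotropic if it contains a line parallel to the $z$-axis; a smooth surface is admissible if none of its tangent planes is isotropic. Write $\mathbf{x}_i=\partial\mathbf{x}/\partial u^i=(x_i^1,x_i^2,x_i^3)$, $\mathbf{x}_{ij}=\partial^2\mathbf{x}/\partial u^i\partial u^j$, $X_{ij}=x_1^ix_2^j-x_1^jx_2^i$ (so $X_{12}\neq0$), $g_{ij}=\langle\mathbf{x}_i,\mathbf{x}_j\rangle_z$, $(g^{ij})=(g_{ij})^{-1}$. A comma followed by an index $c$ denotes $\partial/\partial u^c$; repeated indices are summed over $\{1,2\}$. The isotropic Gauss map is $$\xi=(\xi^1,\xi^2,\xi^3)=\left(\frac{X_{23}}{X_{12}},\ \frac{X_{31}}{X_{12}},\ \frac12\left\{1-\left[\left(\frac{X_{23}}{X_{12}}\right)^2+\left(\frac{X_{31}}{X_{12}}\right)^2\right]\right\}\right),$$ and $\tilde\xi=(\xi^1,\xi^2,0)$, with Euclidean norm $\Vert\tilde\xi\Vert$. One has $\Vert\tilde\xi\Vert^2+\xi^3>0$ and $\{\mathbf{x}_1,\mathbf{x}_2,\xi\}$ is a basis of $\mathbb{R}^3$. The relative connection coefficients $\Xi_{ij}^k$ and the coefficients $\rho_{ij}$ are defined by $\mathbf{x}_{ij}=\Xi_{ij}^k\mathbf{x}_k+\rho_{ij}\,\xi$. The second fundamental form coefficients are $h_{ij}=\det(\mathbf{x}_1,\mathbf{x}_2,\mathbf{x}_{ij})/X_{12}$;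 equivalently $h_{ij}=\langle L(\mathbf{x}_i),\mathbf{x}_j\rangle_z$, where $L(\mathbf{x}_i)=-\partial\xi/\partial u^i$ is the isotropic shape operator. *)

(* Defs.v *)
From HB Require Import structures.
From mathcomp Require Import all_boot all_order all_algebra.
From mathcomp Require Import all_classical all_reals all_analysis.

Set Implicit Arguments.
Unset Strict Implicit.
Unset Printing Implicit Defensive.

Import Order.TTheory GRing.Theory Num.Theory.
Import numFieldNormedType.Exports.

Local Open Scope classical_set_scope.
Local Open Scope ring_scope.

(* All indices are shifted by one: the parameters u^1, u^2 are u 0 0 and u 0 1,
   and the coordinates x^1, x^2, x^3 are x 0 0, x 0 1 and x 0 2. *)

Definition partial (R : realType) (V : normedModType R) (c : 'I_2)
    (f : 'rV[R]_2 -> V) (u : 'rV[R]_2) : V :=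
  'D_(delta_mx 0 c) f u.

Definition iter_partial (R : realType) (V : normedModType R) (s : seq 'I_2)
    (f : 'rV[R]_2 -> V) : 'rV[R]_2 -> V :=
  foldr (@partial R V) f s.

Definition smooth_on (R : realType) (V : normedModType R)
    (U : set 'rV[R]_2) (f : 'rV[R]_2 -> V) : Prop :=
  forall (s : seq 'I_2) (u : 'rV[R]_2), U u ->
    {for u, continuous (iter_partial s f)} /\
    forall c : 'I_2, derivable (iter_partial s f) u (delta_mx 0 c).

Definition regular_at (R : realType) (x : 'rV[R]_2 -> 'rV[R]_3)
    (u : 'rV[R]_2) : Prop :=
  row_free (\matrix_(i < 2) partial i x u).

Definition tangent_plane (R : realType) (x : 'rV[R]_2 -> 'rV[R]_3)
    (u : 'rV[R]_2) : set 'rV[R]_3 :=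
  [set q | exists a : 'I_2 -> R, q = x u + \sum_(i < 2) a i *: partial i x u].

(* The plane P contains a line parallel to the z-axis. *)
Definition isotropic (R : realType) (P : set 'rV[R]_3) : Prop :=
  exists q : 'rV[R]_3, forall t : R, P (q + t *: delta_mx 0 2).

(* A local parameterization of an admissible surface.  Injectivity is not
   required, so self-intersecting patches are allowed. *)
Record admissible_param (R : realType) (U : set 'rV[R]_2)
    (x : 'rV[R]_2 -> 'rV[R]_3) : Prop := AdmissibleParam {
  param_open : open U;
  param_smooth : smooth_on U x;
  param_regular : forall u, U u -> regular_at x u;
  param_admissible : forall u, U u -> ~ isotropic (tangent_plane x u)
}.

Definition dotz (R : realType) (v w : 'rV[R]_3) : R :=
  v 0 0 * w 0 0 + v 0 1 * w 0 1.

Definition enorm (R : realType) (n : nat) (v : 'rV[R]_n) : R :=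
  Num.sqrt (\sum_(i < n) v 0 i ^+ 2).

Section SurfaceGeometry.
Context {R : realType}.
Variable x : 'rV[R]_2 -> 'rV[R]_3.
Implicit Types (u : 'rV[R]_2) (i j : 'I_2) (k l : 'I_3).

Definition X_ k l u : R :=
  partial 0 x u 0 k * partial 1 x u 0 l - partial 0 x u 0 l * partial 1 x u 0 k.

Definition metric u : 'M[R]_2 :=
  \matrix_(i, j) dotz (partial i x u) (partial j x u).

Definition inv_metric u : 'M[R]_2 := invmx (metric u).

Definition gauss_map u : 'rV[R]_3 :=
  let xi1 := X_ 1 2 u / X_ 0 1 u in
  let xi2 := X_ 2 0 u / X_ 0 1 u in
  \row_(k < 3) [:: xi1; xi2; 2^-1 * (1 - (xi1 ^+ 2 + xi2 ^+ 2))]`_k.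

Definition gauss_map_tilde u : 'rV[R]_3 :=
  \row_(k < 3) [:: gauss_map u 0 0; gauss_map u 0 1; 0]`_k.

Definition second_fund u i j : R :=
  \det (\matrix_(k < 3) [:: partial 0 x u; partial 1 x u;
                            partial i (partial j x) u]`_k) / X_ 0 1 u.

(* Xi i j k stands for Xi_{ij}^k.  On U these equations determine Xi and rho,
   as x_1, x_2 and the Gauss map form a basis of the ambient space. *)
Definition relative_connection (U : set 'rV[R]_2)
    (Xi : 'I_2 -> 'I_2 -> 'I_2 -> 'rV[R]_2 -> R)
    (rho : 'I_2 -> 'I_2 -> 'rV[R]_2 -> R) : Prop :=
  forall u, U u -> forall i j,
    partial i (partial j x) u =
      \sum_(k < 2) Xi i j k u *: partial k x u + rho i j u *: gauss_map u.

End SurfaceGeometry.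

(* Main.v *)
Require Import Defs.
From HB Require Import structures.
From mathcomp Require Import all_boot all_order all_algebra.
From mathcomp Require Import all_classical all_reals all_analysis.
From mathcomp Require Import ring.

Import Order.TTheory GRing.Theory Num.Theory.
Import numFieldNormedType.Exports.

Local Open Scope classical_set_scope.
Local Open Scope ring_scope.

(** The point of the proof is to differentiate the structure equation
    x_ab = Xi_ab^k x_k + rho_ab xi along u^c and to compare the result with the
    one obtained after exchanging b and c.  Third partial derivatives of x are
    symmetric (partial_comm3), and {x_1, x_2, xi} is a basis of the ambient
    space (moving_frame_inj), so the coefficients of both expansions agree:
    the tangential ones give the Gauss equation and the transversal ones the
    Codazzi-Mainardi equation.

    The expansion (third_partial) needs the derivative of xi.  Everything
    about xi is read off the linear form nu(v) = xi^1 v^1 + xi^2 v^2 + v^3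
    (normal_form), which is det(x_1, x_2, v) / X_12: it vanishes on the tangent
    plane, satisfies nu(x_ij) = h_ij, and nu(xi) is the weight
    lam = |xi~|^2 + xi^3 = (1 + (xi^1)^2 + (xi^2)^2) / 2 > 0.
    Differentiating the formula for xi^3 gives nu(xi_c) = 0, and
    differentiating nu(x_i) = 0 gives <xi_c, x_i>_z = - h_ci; together they
    force the Weingarten equation xi_c = - h_cd g^de x_e (weingarten).

    Applying nu to the structure equation gives h_ij = lam rho_ij
    (second_fund_rho), from which the three forms of the right-hand side of the
    Gauss equation are equal.

    Two analytic points remain.  Smoothness is only given through iterated
    coordinate derivatives, so the symmetry of mixed derivatives is proved from
    the mean value theorem (derive_comm).  Xi and rho
    are only known through the structure equation; they are derivable because
    nu and Cramer's rule in the (x, y)-plane express them through x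
    (moving_frame_coord). *)

(** * Symmetry of mixed directional derivatives *)

Lemma is_derive_line (R : realType) (V : normedModType R) (f : V -> R)
    (p v : V) (t : R) :
  derivable f (p + t *: v) v ->
  is_derive t 1 (fun s => f (p + s *: v)) ('D_v f (p + t *: v)).
Proof.
have E : (fun h : R => h^-1 *: (f (p + (h%:A + t) *: v) - f (p + t *: v)))
       = (fun h => h^-1 *: (f (h *: v + (p + t *: v)) - f (p + t *: v))).
  by apply/funext => h; rewrite scaler1 scalerDl addrCA.
move=> df; apply: DeriveDef; first by rewrite /derivable /= E.
by rewrite /derive /= E.
Qed.

(** Two applications of the mean value theorem: to the increment of f along
    s w, seen as a function on the segment in the direction v, and then to the
    derivative of f along v on the segment in the direction w. *)
Lemma second_difference_mean (R : realType) (V : normedModType R) (f : V -> R)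
    (u v w : V) (s : R) : 0 < s ->
  (forall a b, 0 <= a <= s -> 0 <= b <= s ->
     derivable f (u + a *: v + b *: w) v /\
     derivable ('D_v f) (u + a *: v + b *: w) w) ->
  exists a b, [/\ 0 <= a <= s, 0 <= b <= s &
    f (u + s *: v + s *: w) - f (u + s *: v) - f (u + s *: w) + f u
      = 'D_w ('D_v f) (u + a *: v + b *: w) * s ^+ 2].
Proof.
move=> s0 df; have s00 : (0 : R) <= 0 <= s by rewrite lexx ltW.
have sss : 0 <= s <= s by rewrite lexx ltW.
pose g a := f (u + s *: w + a *: v) - f (u + a *: v).
pose dg a := 'D_v f (u + s *: w + a *: v) - 'D_v f (u + a *: v).
have gd a : a \in `[0, s]%R -> is_derive a 1 g (dg a).
  rewrite in_itv/= => as_; apply: is_deriveB; apply: is_derive_line.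
  - rewrite addrAC; exact: (df _ _ as_ sss).1.
  - have := (df _ _ as_ s00).1; rewrite scale0r addr0; exact.
have gc : {within `[0, s], continuous g}.
  by apply: derivable_within_continuous => a /gd [].
have gd' a (as_ : a \in `]0, s[%R) := gd a (subset_itv_oo_cc as_).
have [a /subset_itv_oo_cc a0s gE] := @MVT R g dg 0 s s0 gd' gc.
have as_ : 0 <= a <= s by move: a0s; rewrite in_itv.
pose k b := 'D_v f (u + a *: v + b *: w).
have kd b : b \in `[0, s]%R ->
    is_derive b 1 k ('D_w ('D_v f) (u + a *: v + b *: w)).
  rewrite in_itv/= => bs; apply: is_derive_line.
  exact: (df _ _ as_ bs).2.
have kc : {within `[0, s], continuous k}.
  by apply: derivable_within_continuous => b /kd [].
have kd' b (bs : b \in `]0, s[%R) := kd b (subset_itv_oo_cc bs).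
have [b /subset_itv_oo_cc b0s kE] := @MVT R k _ 0 s s0 kd' kc.
exists a, b; split; [exact: as_|by move: b0s; rewrite in_itv|].
move: gE; rewrite /g scale0r !addr0 subr0.
have -> : dg a = k s - k 0 by rewrite /k /dg scale0r addr0 addrAC.
rewrite kE subr0 -mulrA -expr2 => <-.
rewrite opprB addrA.
by rewrite (addrAC _ (- f (u + s *: w))) [u + s *: v + _]addrAC.
Qed.

(** The second difference of f is symmetric in v and w, so the two mixed
    derivatives take a common value up to moving the base point, and the two
    base points may be taken arbitrarily close to u. *)
Lemma derive_comm (R : realType) (V : normedModType R) (f : V -> R)
    (u v w : V) :
  (\forall y \near u, [/\ derivable f y v, derivable f y w,
     derivable ('D_v f) y w & derivable ('D_w f) y v]) ->
  {for u, continuous ('D_w ('D_v f))} -> {for u, continuous ('D_v ('D_w f))} ->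
  'D_w ('D_v f) u = 'D_v ('D_w f) u.
Proof.
move=> fd cwv cvw; apply/subr0_eq/normr0_eq0/eqP; rewrite eq_le normr_ge0 andbT.
apply/ler_addgt0Pl => e e0; rewrite addr0.
have e20 : 0 < e / 2 by rewrite divr_gt0.
move/cvgrPdist_lt : cwv => /(_ _ e20) cwv.
move/cvgrPdist_lt : cvw => /(_ _ e20) cvw.
have [r /= r0 ur] := (nbhs_ballP _ _).1 (filterI fd (filterI cwv cvw)).
(* This side keeps the whole parallelogram inside the ball of radius r. *)
pose s := r / (`|v| + `|w| + 1).
have n0 : 0 < `|v| + `|w| + 1 by rewrite ltr_wpDl// addr_ge0.
have s0 : 0 < s by rewrite divr_gt0.
have near_u a b : 0 <= a <= s -> 0 <= b <= s ->
    ball u r (u + a *: v + b *: w).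
  move=> /andP[a0 as_] /andP[b0 bs]; rewrite -ball_normE /ball_/=.
  rewrite -addrA opprD addNKr normrN (le_lt_trans (ler_normD _ _))//.
  rewrite !normrZ !ger0_norm//.
  apply: (@le_lt_trans _ _ (s * (`|v| + `|w|))).
    by rewrite mulrDr lerD// ler_wpM2r.
  by rewrite /s mulrAC ltr_pdivrMr// ltr_pM2l// ltrDl.
have [a b as_ bs|a [b [as_ bs E1]]] :=
    @second_difference_mean R V f u v w s s0.
  by have [[]] := ur _ (near_u _ _ as_ bs).
have near_u' c d : 0 <= c <= s -> 0 <= d <= s ->
    ball u r (u + c *: w + d *: v).
  by move=> cs ds; rewrite addrAC; exact: near_u.
have [c d cs ds|c [d [cs ds E2]]] :=
    @second_difference_mean R V f u w v s s0.
  by have [[]] := ur _ (near_u' _ _ cs ds).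
have [_ [ur1 _]] := ur _ (near_u _ _ as_ bs).
have [_ [_ ur2]] := ur _ (near_u' _ _ cs ds).
have E : 'D_w ('D_v f) (u + a *: v + b *: w) = 'D_v ('D_w f) (u + c *: w + d *: v).
  have s2 : s ^+ 2 != 0 by rewrite expf_neq0// gt_eqF.
  apply: (mulIf s2).
  apply: etrans (esym E1) _; apply: etrans _ E2.
  rewrite (addrAC u (s *: w)).
  by rewrite (addrAC _ (- f (u + s *: w)) (- f (u + s *: v))).
have tri (p q r' : R) : `|p - r'| < e / 2 -> `|q - r'| < e / 2 -> `|p - q| <= e.
  move=> pr qr; rewrite -(subrKA r') (splitr e).
  apply: (le_trans (ler_normD _ _)); apply: lerD; first exact: ltW.
  by rewrite distrC; exact: ltW.
by apply: (tri _ _ _ ur1); rewrite E.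
Qed.

(** * Partial derivatives of smooth maps on an open set *)

Section Partial.
Context {R : realType} {n : nat}.
Implicit Types (f : 'rV[R]_2 -> 'rV[R]_n) (u : 'rV[R]_2).

Lemma partial_coord f u (c : 'I_2) (k : 'I_n) :
  derivable f u (delta_mx 0 c) ->
  partial c (fun y => f y 0 k) u = partial c f u 0 k.
Proof. by move=> df; rewrite /partial derive_mx// mxE. Qed.

Lemma is_derive_coord f u (c : 'I_2) (k : 'I_n) :
  derivable f u (delta_mx 0 c) ->
  is_derive u (delta_mx 0 c) (fun y => f y 0 k) (partial c f u 0 k).
Proof.
move=> df; apply: DeriveDef; last exact: partial_coord.
exact: (derivable_mxP _ _ _).1 df 0 k.
Qed.

Lemma smooth_derivable {W : normedModType R} {U : set 'rV[R]_2}
    {f : 'rV[R]_2 -> W} {u} (c : 'I_2) :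
  smooth_on U f -> U u -> derivable f u (delta_mx 0 c).
Proof. by move=> fU Uu; have [_] := fU [::] u Uu; exact. Qed.

Lemma smooth_continuous {W : normedModType R} {U : set 'rV[R]_2}
    {f : 'rV[R]_2 -> W} {u} :
  smooth_on U f -> U u -> {for u, continuous f}.
Proof. by move=> fU Uu; have [] := fU [::] u Uu. Qed.

Lemma smooth_partial {W : normedModType R} {U : set 'rV[R]_2}
    {f : 'rV[R]_2 -> W} (c : 'I_2) :
  smooth_on U f -> smooth_on U (partial c f).
Proof.
move=> fU s u Uu; have := fU (rcons s c) u Uu.
by rewrite /iter_partial foldr_rcons.
Qed.

Lemma near_open (U : set 'rV[R]_2) u (P : 'rV[R]_2 -> Prop) :
  open U -> U u -> (forall y, U y -> P y) -> \forall y \near u, P y.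
Proof.
by move=> oU Uu UP; apply: (filterS UP); exact: open_nbhs_nbhs (conj oU Uu).
Qed.

Lemma near_partial {W : normedModType R} (f g : 'rV[R]_2 -> W)
    (U : set 'rV[R]_2) u (c : 'I_2) :
  open U -> U u -> (forall y, U y -> f y = g y) ->
  partial c f u = partial c g u.
Proof. by move=> oU Uu fg; apply: near_eq_derive; exact: (near_open U). Qed.

(** Schwarz's theorem is applied to each coordinate; the second derivatives of a
    coordinate agree with the coordinates of the second derivatives only on U,
    which suffices as U is a neighbourhood of u. *)
Lemma partial_comm (U : set 'rV[R]_2) f u (b c : 'I_2) :
  open U -> smooth_on U f -> U u ->
  partial c (partial b f) u = partial b (partial c f) u.
Proof.
move=> oU fU Uu.
have coord1 a k y : U y ->
    partial a f y 0 k = 'D_(delta_mx 0 a) (fun y => f y 0 k) y.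
  by move=> Uy; rewrite -[RHS]/(partial a _ y) partial_coord//;
     exact: smooth_derivable fU Uy.
have d1 (a a' : 'I_2) k y : U y ->
    derivable ('D_(delta_mx 0 a) (fun y => f y 0 k)) y (delta_mx 0 a').
  move=> Uy; apply: (@near_eq_derivable _ _ _ (fun y => partial a f y 0 k)).
    by apply: (near_open U) => // z; exact: coord1.
  apply: (derivable_mxP _ _ _).1.
  exact: smooth_derivable (smooth_partial a fU) Uy.
have coord2 a a' k y : U y -> partial a' (partial a f) y 0 k =
    'D_(delta_mx 0 a') ('D_(delta_mx 0 a) (fun y => f y 0 k)) y.
  move=> Uy; rewrite -partial_coord.
    by apply: (near_partial _ _ U) => // z; exact: coord1.
  exact: smooth_derivable (smooth_partial a fU) Uy.
have cont2 (a a' : 'I_2) k : {for u, continuous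
    ('D_(delta_mx 0 a') ('D_(delta_mx 0 a) (fun y => f y 0 k)))}.
  have cc : (partial a' (partial a f) y 0 k) @[y --> u] -->
      partial a' (partial a f) u 0 k.
    apply: (@continuous_comp _ _ _ (partial a' (partial a f)) (fun M => M 0 k)).
      exact: smooth_continuous (smooth_partial a' (smooth_partial a fU)) Uu.
    exact: coord_continuous.
  rewrite /prop_for /continuous_at -(coord2 a a' k u Uu).
  exact: cvg_trans (near_eq_cvg (near_open U u _ oU Uu (coord2 a a' k))) cc.
apply/rowP => k.
apply: etrans (coord2 b c k u Uu) _; apply: etrans _ (esym (coord2 c b k u Uu)).
refine (@derive_comm R _ (fun y => f y 0 k) u (delta_mx 0 b) (delta_mx 0 c)
  _ (cont2 b c k) (cont2 c b k)).
apply: (near_open U _ _ oU Uu) => y Uy.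
have fd a : derivable (fun y => f y 0 k) y (delta_mx 0 a).
  by apply: (derivable_mxP _ _ _).1; exact: smooth_derivable fU Uy.
split; [exact: fd|exact: fd| |].
- exact: (d1 b c k y Uy).
- exact: (d1 c b k y Uy).
Qed.

Lemma partial_comm3 (U : set 'rV[R]_2) f u (a b c : 'I_2) :
  open U -> smooth_on U f -> U u ->
  partial c (partial a (partial b f)) u = partial b (partial a (partial c f)) u.
Proof.
move=> oU fU Uu.
apply: etrans (near_partial _ _ U u c oU Uu
  (fun y Uy => partial_comm U f y b a oU fU Uy)) _.
apply: etrans (partial_comm U (partial a f) u b c oU (smooth_partial a fU) Uu) _.
exact: near_partial _ _ U u b oU Uu
  (fun y Uy => partial_comm U f y a c oU fU Uy).
Qed.

End Partial.

(** * Sums and determinants in dimensions two and three *)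

Lemma sum_I2 (V : nmodType) (F : 'I_2 -> V) : \sum_(d < 2) F d = F 0 + F 1.
Proof.
by rewrite !big_ord_recl big_ord0 addr0; congr (_ + F _); apply/val_inj.
Qed.

Lemma sum_I3 (V : nmodType) (F : 'I_3 -> V) :
  \sum_(d < 3) F d = F 0 + F 1 + F 2.
Proof.
rewrite !big_ord_recl big_ord0 addr0 addrA.
by congr (_ + F _ + F _); apply/val_inj.
Qed.

Lemma forall_I2 (P : 'I_2 -> Prop) : P 0 -> P 1 -> forall i, P i.
Proof.
move=> P0 P1 [[|[|//]] i2].
- by rewrite (_ : Ordinal i2 = 0)//; exact/val_inj.
- by rewrite (_ : Ordinal i2 = 1)//; exact/val_inj.
Qed.

Lemma forall_I3 (P : 'I_3 -> Prop) : P 0 -> P 1 -> P 2 -> forall k, P k.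
Proof.
move=> P0 P1 P2 [[|[|[|//]]] k3].
- by rewrite (_ : Ordinal k3 = 0)//; exact/val_inj.
- by rewrite (_ : Ordinal k3 = 1)//; exact/val_inj.
- by rewrite (_ : Ordinal k3 = 2)//; exact/val_inj.
Qed.

Lemma det2 (K : comNzRingType) (A : 'M[K]_2) :
  \det A = A 0 0 * A 1 1 - A 0 1 * A 1 0.
Proof.
rewrite (expand_det_row _ 0) sum_I2 /cofactor !det_mx11 !mxE.
have -> : lift (0 : 'I_2) 0 = 1 by exact/val_inj.
have -> : lift (1 : 'I_2) 0 = 0 by exact/val_inj.
by rewrite /= expr0 expr1 mul1r mulN1r mulrN.
Qed.

Lemma det3 (K : comNzRingType) (A : 'M[K]_3) :
  \det A = A 0 0 * (A 1 1 * A 2 2 - A 1 2 * A 2 1)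
         - A 0 1 * (A 1 0 * A 2 2 - A 1 2 * A 2 0)
         + A 0 2 * (A 1 0 * A 2 1 - A 1 1 * A 2 0).
Proof.
rewrite (expand_det_row _ 0) sum_I3 /cofactor !det2 !mxE.
have -> : lift (0 : 'I_3) 0 = 1 by exact/val_inj.
have -> : lift (0 : 'I_3) 1 = 2 by exact/val_inj.
have -> : lift (1 : 'I_3) 0 = 0 by exact/val_inj.
have -> : lift (1 : 'I_3) 1 = 2 by exact/val_inj.
have -> : lift (2 : 'I_3) 0 = 0 by exact/val_inj.
have -> : lift (2 : 'I_3) 1 = 1 by exact/val_inj.
rewrite /= !add0n expr0 expr1 sqrrN expr1n !mul1r mulN1r mulrN; ring.
Qed.

Lemma row_addE (K : nmodType) (n : nat) (v w : 'rV[K]_n) k :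
  (v + w) 0 k = v 0 k + w 0 k.
Proof. by rewrite mxE. Qed.

Lemma row_scaleE (K : pzRingType) (n : nat) (a : K) (v : 'rV[K]_n) k :
  (a *: v) 0 k = a * v 0 k.
Proof. by rewrite mxE. Qed.

(** * Linear algebra of a pair of spanning vectors *)

Section TangentPair.
Context {R : realType}.
Implicit Types p q v : 'rV[R]_3.

(** For p = x_1 and q = x_2 these are, definitionally, the X_kl; stating the
    linear algebra for arbitrary p and q keeps derivatives out of it. *)
Definition minor2 p q (k l : 'I_3) : R := p 0 k * q 0 l - p 0 l * q 0 k.

(** When the shadows of v_1 and v_2 in the (x, y)-plane are dependent, a
    nontrivial combination of v_1 and v_2 is vertical, and it is nonzero because
    v_1 and v_2 are independent. *)
Lemma vertical_direction (v : 'I_2 -> 'rV[R]_3) :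
  row_free (\matrix_(i < 2) v i) -> minor2 (v 0) (v 1) 0 1 = 0 ->
  exists a : 'I_2 -> R, \sum_(i < 2) a i *: v i = delta_mx 0 2.
Proof.
move=> vfree X0.
pose A : 'M[R]_2 := \matrix_(i < 2) \row_(k < 2) v i 0 (widen_ord (leqnSn 2) k).
have A0 i : A i 0 = v i 0 0.
  by rewrite !mxE; congr (v i _ _); exact/val_inj.
have A1 i : A i 1 = v i 0 1.
  by rewrite !mxE; congr (v i _ _); exact/val_inj.
have /eqP/det0P[a a0 aA] : \det A = 0.
  by rewrite det2 !A0 !A1; exact: X0.
pose w := \sum_(i < 2) a 0 i *: v i.
have w0 : w != 0.
  have -> : w = a *m \matrix_(i < 2) v i.
    by rewrite mulmx_sum_row; apply: eq_bigr => i _; rewrite rowK.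
  by rewrite mulmx_free_eq0.
have wk k : w 0 k = a 0 0 * v 0 0 k + a 0 1 * v 1 0 k.
  by rewrite /w sum_I2 row_addE !row_scaleE.
have w00 : w 0 0 = 0.
  by move/rowP/(_ 0): aA; rewrite mxE sum_I2 !A0 mxE wk.
have w01 : w 0 1 = 0.
  by move/rowP/(_ 1): aA; rewrite mxE sum_I2 !A1 mxE wk.
have wE : w = w 0 2 *: delta_mx 0 2.
  by apply/rowP; apply: forall_I3; rewrite !mxE/= -?wk ?w00 ?w01 ?mulr0 ?mulr1.
have w02 : w 0 2 != 0.
  by apply: contra_neq w0 => w20; rewrite wE w20 scale0r.
exists (fun i => (w 0 2)^-1 * a 0 i).
under eq_bigr do rewrite -scalerA.
by rewrite -scaler_sumr -/w {2}wE scalerA mulVf// scale1r.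
Qed.

(** With the next lemma: the expansions of det(p, q, p) = 0 and det(p, q, q) = 0
    along the last row, divided by the minor. *)
Lemma minor2_normal_l p q : minor2 p q 0 1 != 0 ->
  minor2 p q 1 2 / minor2 p q 0 1 * p 0 0
  + minor2 p q 2 0 / minor2 p q 0 1 * p 0 1 + p 0 2 = 0.
Proof. by rewrite /minor2 => X0; field. Qed.

Lemma minor2_normal_r p q : minor2 p q 0 1 != 0 ->
  minor2 p q 1 2 / minor2 p q 0 1 * q 0 0
  + minor2 p q 2 0 / minor2 p q 0 1 * q 0 1 + q 0 2 = 0.
Proof. by rewrite /minor2 => X0; field. Qed.

Lemma det_minor2 p q v : minor2 p q 0 1 != 0 ->
  \det (\matrix_(k < 3) [:: p; q; v]`_k) / minor2 p q 0 1 =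
  minor2 p q 1 2 / minor2 p q 0 1 * v 0 0
  + minor2 p q 2 0 / minor2 p q 0 1 * v 0 1 + v 0 2.
Proof. by rewrite det3 !mxE/= /minor2 => X0; field. Qed.

Lemma eq0_dotz_pair p q v : minor2 p q 0 1 != 0 ->
  dotz v p = 0 -> dotz v q = 0 -> v 0 0 = 0 /\ v 0 1 = 0.
Proof.
move=> X0 vp vq; split; apply: (mulIf X0); rewrite mul0r.
- have -> : v 0 0 * minor2 p q 0 1 = dotz v p * q 0 1 - dotz v q * p 0 1.
    by rewrite /minor2 /dotz; ring.
  by rewrite vp vq !mul0r subrr.
- have -> : v 0 1 * minor2 p q 0 1 = dotz v q * p 0 0 - dotz v p * q 0 0.
    by rewrite /minor2 /dotz; ring.
  by rewrite vp vq !mul0r subrr.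
Qed.

Lemma planar_cramer p q (a b : R) (v := a *: p + b *: q) :
  minor2 p q 0 1 != 0 ->
  a = minor2 v q 0 1 / minor2 p q 0 1 /\ b = minor2 p v 0 1 / minor2 p q 0 1.
Proof.
rewrite /v /minor2 !row_addE !row_scaleE => X0.
by split; field.
Qed.

Lemma dotzC p q : dotz p q = dotz q p.
Proof. by rewrite /dotz; ring. Qed.

Lemma dotz_comb (a b : R) p q v z :
  dotz (a *: p + b *: q + v) z = a * dotz p z + b * dotz q z + dotz v z.
Proof. by rewrite /dotz !row_addE !row_scaleE; ring. Qed.

Lemma gram_minor2 p q :
  dotz p p * dotz q q - dotz p q * dotz q p = minor2 p q 0 1 ^+ 2.
Proof. by rewrite /dotz /minor2; ring. Qed.

End TangentPair.

(** * The linear form dual to the isotropic Gauss map *)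

Section NormalForm.
Context {R : realType} (x : 'rV[R]_2 -> 'rV[R]_3).
Implicit Types (u : 'rV[R]_2) (v w : 'rV[R]_3).

(** The linear form det(x_1, x_2, v) / X_12: its kernel is the tangent plane
    and its coefficients are the first two coordinates of the Gauss map. *)
Definition normal_form u v : R :=
  gauss_map x u 0 0 * v 0 0 + gauss_map x u 0 1 * v 0 1 + v 0 2.

Definition normal_weight u : R :=
  enorm (gauss_map_tilde x u) ^+ 2 + gauss_map x u 0 2.

Lemma gauss_map0 u : gauss_map x u 0 0 = X_ x 1 2 u / X_ x 0 1 u.
Proof. by rewrite mxE. Qed.

Lemma gauss_map1 u : gauss_map x u 0 1 = X_ x 2 0 u / X_ x 0 1 u.
Proof. by rewrite mxE. Qed.

Lemma gauss_map2 u : gauss_map x u 0 2 =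
  2^-1 * (1 - (gauss_map x u 0 0 ^+ 2 + gauss_map x u 0 1 ^+ 2)).
Proof. by rewrite gauss_map0 gauss_map1 mxE. Qed.

Lemma normal_weightE u : normal_weight u =
  2^-1 * (1 + gauss_map x u 0 0 ^+ 2 + gauss_map x u 0 1 ^+ 2).
Proof.
have t0 : gauss_map_tilde x u 0 0 = gauss_map x u 0 0 by rewrite mxE.
have t1 : gauss_map_tilde x u 0 1 = gauss_map x u 0 1 by rewrite mxE.
have t2 : gauss_map_tilde x u 0 2 = 0 by rewrite mxE.
rewrite /normal_weight /enorm sqr_sqrtr; last first.
  by apply: sumr_ge0 => k _; exact: sqr_ge0.
by rewrite sum_I3 t0 t1 t2 gauss_map2; field.
Qed.

Lemma normal_weight_gt0 u : 0 < normal_weight u.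
Proof.
rewrite normal_weightE mulr_gt0 ?invr_gt0//.
by rewrite -addrA ltr_pwDl// addr_ge0// sqr_ge0.
Qed.

Lemma normal_form_comb u (a b : R) v w z :
  normal_form u (a *: v + b *: w + z) =
  a * normal_form u v + b * normal_form u w + normal_form u z.
Proof. by rewrite /normal_form !mxE; ring. Qed.

Lemma normal_formZ u (a : R) v : normal_form u (a *: v) = a * normal_form u v.
Proof. by rewrite /normal_form !mxE; ring. Qed.

Lemma normal_form_gauss u : normal_form u (gauss_map x u) = normal_weight u.
Proof. by rewrite /normal_form normal_weightE gauss_map2; field. Qed.

End NormalForm.

(** * The moving frame *)

Section TangentPlane.
Context {R : realType} {U : set 'rV[R]_2} {x : 'rV[R]_2 -> 'rV[R]_3}.
Hypothesis hx : admissible_param U x.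
Context {u : 'rV[R]_2} (hu : U u).
Implicit Types v : 'rV[R]_3.

(** Were X_12 zero, the tangent plane would contain a vertical line. *)
Lemma X_neq0 : minor2 (partial 0 x u) (partial 1 x u) 0 1 != 0.
Proof.
apply/negP => /eqP X0; apply: (param_admissible hx hu).
have [a aE] := vertical_direction _ (param_regular hx hu) X0.
exists (x u) => t; exists (fun i => t * a i); congr (_ + _).
by under eq_bigr do rewrite -scalerA; rewrite -scaler_sumr aE.
Qed.

Lemma normal_form_tangent i : normal_form x u (partial i x u) = 0.
Proof.
move: i; apply: forall_I2; rewrite /normal_form gauss_map0 gauss_map1.
- exact: minor2_normal_l X_neq0.
- exact: minor2_normal_r X_neq0.
Qed.

Lemma second_fundE i j :
  second_fund x u i j = normal_form x u (partial i (partial j x) u).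
Proof.
rewrite /normal_form gauss_map0 gauss_map1.
exact: det_minor2 X_neq0.
Qed.

(** The degenerate product against x_1 and x_2 controls the first two coordinates
    of v, and the normal form then controls the third. *)
Lemma eq0_dotz_normal v : (forall i, dotz v (partial i x u) = 0) ->
  normal_form x u v = 0 -> v = 0.
Proof.
move=> vt vn; have [v0 v1] := eq0_dotz_pair _ _ _ X_neq0 (vt 0) (vt 1).
have v2 : v 0 2 = 0.
  by move: vn; rewrite /normal_form v0 v1 !mulr0 !add0r.
by apply/rowP; apply: forall_I3; rewrite [RHS]mxE.
Qed.

(** Coordinates in the frame {x_1, x_2, xi}: the normal form isolates the xi
    component, and Cramer's rule in the (x, y)-plane gives the others.  Besides
    uniqueness, these formulas show that the coordinates of a differentiable
    vector field are differentiable. *)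
Lemma moving_frame_coord (a : 'I_2 -> R) (r : R) (v : 'rV[R]_3)
    (w := v - (normal_form x u v / normal_weight x u) *: gauss_map x u) :
  v = \sum_(k < 2) a k *: partial k x u + r *: gauss_map x u ->
  [/\ r = normal_form x u v / normal_weight x u,
      a 0 = minor2 w (partial 1 x u) 0 1 / X_ x 0 1 u &
      a 1 = minor2 (partial 0 x u) w 0 1 / X_ x 0 1 u].
Proof.
move=> vE; have rE : r = normal_form x u v / normal_weight x u.
  rewrite vE sum_I2 normal_form_comb normal_formZ.
  rewrite (normal_form_tangent 0) (normal_form_tangent 1).
  by rewrite normal_form_gauss !mulr0 !add0r mulfK// gt_eqF// normal_weight_gt0.
have wE : w = a 0 *: partial 0 x u + a 1 *: partial 1 x u.
  by rewrite /w -rE vE sum_I2 addrK.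
have [a0 a1] := planar_cramer _ _ (a 0) (a 1) X_neq0.
by split=> //; rewrite wE.
Qed.

Lemma moving_frame_inj (a b : 'I_2 -> R) (r s : R) :
  \sum_(k < 2) a k *: partial k x u + r *: gauss_map x u =
  \sum_(k < 2) b k *: partial k x u + s *: gauss_map x u ->
  (forall k, a k = b k) /\ r = s.
Proof.
move=> E; have [r1 a0 a1] := moving_frame_coord a r _ erefl.
have [s1 b0 b1] := moving_frame_coord b s _ E.
split; last by rewrite r1 s1.
by apply: forall_I2; rewrite ?a0 ?b0 ?a1 ?b1.
Qed.

Lemma metricE i j : metric x u i j = dotz (partial i x u) (partial j x u).
Proof. by rewrite [LHS]mxE. Qed.

Lemma metric_unit : metric x u \in unitmx.
Proof.
rewrite unitmxE det2 unitfE !metricE gram_minor2.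
by rewrite expf_neq0// X_neq0.
Qed.

(** Raising and then lowering an index is the identity. *)
Lemma metric_raise (w : 'I_2 -> R) j :
  \sum_(e < 2) (\sum_(d < 2) w d * inv_metric x u e d) * metric x u e j = w j.
Proof.
have gT i k : metric x u i k = metric x u k i.
  by rewrite !metricE; exact: dotzC.
under eq_bigr do rewrite mulr_suml.
rewrite exchange_big /=.
rewrite (eq_bigr (fun d => w d * (1%:M : 'M[R]_2) j d)).
  rewrite (bigD1 j)//= big1 ?mxE ?eqxx ?mulr1 ?addr0// => d dj.
  by rewrite mxE eq_sym (negbTE dj) mulr0.
move=> d _; rewrite -(mulmxV metric_unit) mxE mulr_sumr; apply: eq_bigr => e _.
by rewrite gT -mulrA [_ * metric _ _ _ _]mulrC.
Qed.

End TangentPlane.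

(** * Pointwise rules for directional derivatives *)

Section DerivativeRules.
Context {R : realType} {V : normedModType R} {u v : V}.
Implicit Types f g : V -> R.

Lemma is_derive_unique {W : normedModType R} {f : V -> W} {df df' : W} :
  is_derive u v f df -> is_derive u v f df' -> df = df'.
Proof. by move=> [_ <-] [_ <-]. Qed.

(** Stated for lambda-abstracted expressions rather than for the ring of functions, so
    that the rules apply by unification. *)
Lemma is_derive_add f g df dg : is_derive u v f df -> is_derive u v g dg ->
  is_derive u v (fun y => f y + g y) (df + dg).
Proof. exact: is_deriveD. Qed.

Lemma is_derive_mul f g df dg : is_derive u v f df -> is_derive u v g dg ->
  is_derive u v (fun y => f y * g y) (f u * dg + g u * df).
Proof. exact: is_deriveM. Qed.

Lemma derivable_sub f g : derivable f u v -> derivable g u v ->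
  derivable (fun y => f y - g y) u v.
Proof. exact: derivableB. Qed.

Lemma derivable_add f g : derivable f u v -> derivable g u v ->
  derivable (fun y => f y + g y) u v.
Proof. exact: derivableD. Qed.

Lemma derivable_mul f g : derivable f u v -> derivable g u v ->
  derivable (fun y => f y * g y) u v.
Proof. exact: derivableM. Qed.

Lemma derivable_div f g : g u != 0 -> derivable f u v -> derivable g u v ->
  derivable (fun y => f y / g y) u v.
Proof. by move=> g0 df dg; exact: derivable_mul df (derivableV g0 dg). Qed.

Lemma derivable_row {n : nat} (f : V -> 'rV[R]_n) :
  (forall k, derivable (fun y => f y 0 k) u v) -> derivable f u v.
Proof. by move=> df; apply/derivable_mxP => i k; rewrite ord1. Qed.

Lemma derivable_coord {n : nat} (f : V -> 'rV[R]_n) k :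
  derivable f u v -> derivable (fun y => f y 0 k) u v.
Proof. by move=> df; exact: (derivable_mxP _ _ _).1 df 0 k. Qed.

Lemma derivable_minor2 (f g : V -> 'rV[R]_3) k l :
  derivable f u v -> derivable g u v ->
  derivable (fun y => minor2 (f y) (g y) k l) u v.
Proof.
by move=> df dg; apply: derivable_sub; apply: derivable_mul;
  exact: derivable_coord.
Qed.

Lemma is_derive_scale {n : nat} (s : V -> R) (f : V -> 'rV[R]_n) :
  derivable s u v -> derivable f u v ->
  is_derive u v (fun y => s y *: f y) ('D_v s u *: f u + s u *: 'D_v f u).
Proof.
move=> ds df.
have dk k : is_derive u v (fun y => (s y *: f y) 0 k)
    (('D_v s u *: f u + s u *: 'D_v f u) 0 k).
  have -> : (fun y => (s y *: f y) 0 k) = (fun y => s y * f y 0 k).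
    by apply/funext => y; rewrite row_scaleE.
  have -> : ('D_v s u *: f u + s u *: 'D_v f u) 0 k =
      s u * 'D_v (fun y => f y 0 k) u + f u 0 k * 'D_v s u.
    by rewrite derive_mx// !mxE addrC [in RHS](mulrC (f u 0 k)).
  exact: is_derive_mul (derivableP ds) (derivableP (derivable_coord _ k df)).
have dsf : derivable (fun y => s y *: f y) u v.
  by apply: derivable_row => k; have [] := dk k.
apply: DeriveDef => //; apply/rowP => k.
by rewrite derive_mx// mxE; have [_ ->] := dk k.
Qed.

End DerivativeRules.

(** * The Weingarten equation *)

Section Weingarten.
Context {R : realType} {U : set 'rV[R]_2} {x : 'rV[R]_2 -> 'rV[R]_3}.
Hypothesis hx : admissible_param U x.
Implicit Types (u : 'rV[R]_2) (i j c : 'I_2).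

Lemma derivable_partial u i c : U u ->
  derivable (partial i x) u (delta_mx 0 c).
Proof. exact: smooth_derivable (smooth_partial i (param_smooth hx)). Qed.

Lemma derivable_partial2 u i j c : U u ->
  derivable (partial i (partial j x)) u (delta_mx 0 c).
Proof.
exact: smooth_derivable (smooth_partial i (smooth_partial j (param_smooth hx))).
Qed.

Lemma derivable_X u k l c : U u ->
  derivable (X_ x k l) u (delta_mx 0 c).
Proof.
by move=> Uu; exact: (derivable_minor2 (partial 0 x) (partial 1 x) k l
  (derivable_partial _ 0 c Uu) (derivable_partial _ 1 c Uu)).
Qed.

Lemma derivable_gauss u c : U u -> derivable (gauss_map x) u (delta_mx 0 c).
Proof.
move=> Uu; have X0 := X_neq0 hx Uu.
have d0 : derivable (fun y => gauss_map x y 0 0) u (delta_mx 0 c).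
  rewrite (_ : (fun y => _) = fun y => X_ x 1 2 y / X_ x 0 1 y).
    exact: (derivable_div (X_ x 1 2) (X_ x 0 1) X0
      (derivable_X _ _ _ _ Uu) (derivable_X _ _ _ _ Uu)).
  by apply/funext => y; rewrite gauss_map0.
have d1 : derivable (fun y => gauss_map x y 0 1) u (delta_mx 0 c).
  rewrite (_ : (fun y => _) = fun y => X_ x 2 0 y / X_ x 0 1 y).
    exact: (derivable_div (X_ x 2 0) (X_ x 0 1) X0
      (derivable_X _ _ _ _ Uu) (derivable_X _ _ _ _ Uu)).
  by apply/funext => y; rewrite gauss_map1.
apply: derivable_row; apply: forall_I3; [exact: d0|exact: d1|].
rewrite (_ : (fun y => _) = fun y => 2^-1 * (1 -
    (gauss_map x y 0 0 * gauss_map x y 0 0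
     + gauss_map x y 0 1 * gauss_map x y 0 1))).
  apply: derivable_mul; first exact: derivable_cst.
  apply: derivable_sub; first exact: derivable_cst.
  exact: derivable_add (derivable_mul _ _ d0 d0) (derivable_mul _ _ d1 d1).
by apply/funext => y; rewrite gauss_map2 !expr2.
Qed.

(** Product rule: only the first two coefficients of the normal form vary, and
    their derivatives pair with v through the degenerate inner product. *)
Lemma is_derive_normal_form (v : 'rV[R]_2 -> 'rV[R]_3) u c : U u ->
  derivable v u (delta_mx 0 c) ->
  is_derive u (delta_mx 0 c) (fun y => normal_form x y (v y))
    (dotz (partial c (gauss_map x) u) (v u) + normal_form x u (partial c v u)).
Proof.
move=> Uu dv; have dg := derivable_gauss _ c Uu.
have g k := is_derive_coord _ _ c k dg.
have w k := is_derive_coord _ _ c k dv.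
have := is_derive_add _ _ _ _ (is_derive_add _ _ _ _
  (is_derive_mul _ _ _ _ (g 0) (w 0)) (is_derive_mul _ _ _ _ (g 1) (w 1))) (w 2).
move=> [dn nE]; apply: (DeriveDef dn); rewrite nE /dotz /normal_form.
move: (partial c v u) (partial c (gauss_map x) u) => dw dxi; ring.
Qed.

(** Derivative of xi^3 = (1 - (xi^1)^2 - (xi^2)^2) / 2: the derivatives of the
    Gauss map are tangent to the surface. *)
Lemma normal_form_gauss_partial u c : U u ->
  normal_form x u (partial c (gauss_map x) u) = 0.
Proof.
move=> Uu; have dg := derivable_gauss _ c Uu.
have g k := is_derive_coord _ _ c k dg.
have gg k := is_derive_mul _ _ _ _ (g k) (g k).
have E : (fun y => gauss_map x y 0 2) = (fun y => 2^-1 * (1 + -1 *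
    (gauss_map x y 0 0 * gauss_map x y 0 0
     + gauss_map x y 0 1 * gauss_map x y 0 1))).
  by apply/funext => y; rewrite gauss_map2 !expr2 mulN1r.
have := is_derive_mul _ _ _ _ (is_derive_cst (2^-1 : R) u (delta_mx 0 c))
  (is_derive_add _ _ _ _ (is_derive_cst (1 : R) u (delta_mx 0 c))
    (is_derive_mul _ _ _ _ (is_derive_cst (-1 : R) u (delta_mx 0 c))
      (is_derive_add _ _ _ _ (gg 0) (gg 1)))).
have g2 := g 2; rewrite E in g2 => /(is_derive_unique g2).
rewrite /normal_form /cst => ->.
by move: (partial c (gauss_map x) u) (gauss_map x u) => dxi xi; field.
Qed.

(** Obtained by differentiating the vanishing of the normal form on x_i. *)
Lemma dotz_gauss_partial u c i : U u ->
  dotz (partial c (gauss_map x) u) (partial i x u) = - second_fund x u c i.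
Proof.
move=> Uu; rewrite (second_fundE hx Uu); apply/eqP; rewrite -addr_eq0; apply/eqP.
apply: is_derive_unique
  (is_derive_normal_form (partial i x) u c Uu (derivable_partial _ _ _ Uu)) _.
apply: near_eq_is_derive (is_derive_cst (0 : R) u (delta_mx 0 c)).
apply: (near_open U u _ (param_open hx) Uu) => y Uy.
by rewrite (normal_form_tangent hx Uy).
Qed.

(** The two sides have the same normal form and the same products with x_1 and
    x_2, and these determine a vector. *)
Lemma weingarten u c : U u -> partial c (gauss_map x) u =
  - \sum_(e < 2)
      (\sum_(d < 2) second_fund x u c d * inv_metric x u e d) *: partial e x u.
Proof.
move=> Uu; apply/eqP; rewrite -addr_eq0 addrC sum_I2; apply/eqP.
apply: (eq0_dotz_normal hx Uu) => [j|].
  have := metric_raise hx Uu (second_fund x u c) j.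
  rewrite sum_I2 (metricE 0 j) (metricE 1 j) => raise.
  by rewrite dotz_comb (dotz_gauss_partial _ _ _ Uu) raise subrr.
rewrite normal_form_comb normal_form_gauss_partial//.
by rewrite (normal_form_tangent hx Uu 0) (normal_form_tangent hx Uu 1)
  !mulr0 !addr0.
Qed.

End Weingarten.

(** * Differentiating the structure equation *)

Section StructureEquations.
Context {R : realType} {U : set 'rV[R]_2} {x : 'rV[R]_2 -> 'rV[R]_3}.
Context {Xi : 'I_2 -> 'I_2 -> 'I_2 -> 'rV[R]_2 -> R}.
Context {rho : 'I_2 -> 'I_2 -> 'rV[R]_2 -> R}.
Hypothesis hx : admissible_param U x.
Hypothesis hXi : relative_connection x U Xi rho.
Context {u : 'rV[R]_2} (Uu : U u).
Implicit Types a b c d e : 'I_2.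

Let near_U (P : 'rV[R]_2 -> Prop) :
  (forall y, U y -> P y) -> \forall y \near u, P y.
Proof. exact: near_open (param_open hx) Uu. Qed.

(** The normal form applied to the structure equation. *)
Lemma second_fund_rho a b : second_fund x u a b = normal_weight x u * rho a b u.
Proof.
have [-> _ _] := moving_frame_coord hx Uu _ _ _ (hXi _ Uu a b).
by rewrite (second_fundE hx Uu) mulrC divfK// gt_eqF// normal_weight_gt0.
Qed.

(** On U, rho_ab is the quotient of the normal forms of x_ab and of xi. *)
Lemma derivable_rho a b c : derivable (rho a b) u (delta_mx 0 c).
Proof.
apply: (@near_eq_derivable _ _ _ (fun y =>
    normal_form x y (partial a (partial b x) y) / normal_form x y (gauss_map x y))).
  apply: near_U => y Uy; rewrite normal_form_gauss.
  by have [-> _ _] := moving_frame_coord hx Uy _ _ _ (hXi _ Uy a b).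
apply: (derivable_div
  (fun y => normal_form x y (partial a (partial b x) y))
  (fun y => normal_form x y (gauss_map x y))).
- by rewrite normal_form_gauss gt_eqF// normal_weight_gt0.
- by have [] := is_derive_normal_form hx _ _ _ Uu
    (derivable_partial2 hx _ a b c Uu).
- by have [] := is_derive_normal_form hx _ _ _ Uu (derivable_gauss hx _ c Uu).
Qed.

(** On U, the Xi_ab^e are given by Cramer's rule for x_ab - rho_ab xi, which is
    differentiable because rho_ab is. *)
Lemma derivable_Xi a b e c : derivable (Xi a b e) u (delta_mx 0 c).
Proof.
pose w y := partial a (partial b x) y - rho a b y *: gauss_map x y.
have dw : derivable w u (delta_mx 0 c).
  apply: derivableB; first exact: (derivable_partial2 hx _ a b c Uu).
  by have [] := is_derive_scale _ _ (derivable_rho a b c)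
    (derivable_gauss hx _ c Uu).
have [dp dq] := (derivable_partial hx _ 0 c Uu, derivable_partial hx _ 1 c Uu).
have wE y : U y -> Xi a b 0 y = minor2 (w y) (partial 1 x y) 0 1 / X_ x 0 1 y
    /\ Xi a b 1 y = minor2 (partial 0 x y) (w y) 0 1 / X_ x 0 1 y.
  move=> Uy; rewrite /w.
  by have [-> ? ?] := moving_frame_coord hx Uy _ _ _ (hXi _ Uy a b).
move: e; apply: forall_I2.
- apply: (@near_eq_derivable _ _ _
    (fun y => minor2 (w y) (partial 1 x y) 0 1 / X_ x 0 1 y)).
    by apply: near_U => y /wE[->].
  exact: (derivable_div (fun y => minor2 (w y) (partial 1 x y) 0 1) (X_ x 0 1)
    (X_neq0 hx Uu) (derivable_minor2 w (partial 1 x) 0 1 dw dq)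
    (derivable_X hx _ 0 1 c Uu)).
- apply: (@near_eq_derivable _ _ _
    (fun y => minor2 (partial 0 x y) (w y) 0 1 / X_ x 0 1 y)).
    by apply: near_U => y /wE[_ ->].
  exact: (derivable_div (fun y => minor2 (partial 0 x y) (w y) 0 1) (X_ x 0 1)
    (X_neq0 hx Uu) (derivable_minor2 (partial 0 x) w 0 1 dp dw)
    (derivable_X hx _ 0 1 c Uu)).
Qed.

(** Regrouping of the derivative of a0 p + a1 q + r g along the frame (p, q, g),
    where p, q and g have derivatives b00 p + b01 q + s0 g, b10 p + b11 q + s1 g
    and - (t0 p + t1 q). *)
Lemma frame_collect (p q g : 'rV[R]_3) (a0 a1 r da0 da1 dr : R)
    (b00 b01 b10 b11 s0 s1 t0 t1 : R) :
  (da0 *: p + a0 *: (b00 *: p + b01 *: q + s0 *: g))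
  + (da1 *: q + a1 *: (b10 *: p + b11 *: q + s1 *: g))
  + (dr *: g + r *: - (t0 *: p + t1 *: q)) =
  (da0 + (a0 * b00 + a1 * b10) - r * t0) *: p
  + (da1 + (a0 * b01 + a1 * b11) - r * t1) *: q
  + (dr + (a0 * s0 + a1 * s1)) *: g.
Proof. by apply/rowP => k; rewrite !mxE; ring. Qed.

(** The product rule applied to the structure equation, in which the derivatives
    of x_1 and x_2 are expanded by the structure equation again and that of xi
    by the Weingarten equation. *)
Lemma third_partial a b c :
  let h := second_fund x u in
  partial c (partial a (partial b x)) u =
  \sum_(e < 2)
     (partial c (Xi a b e) u + \sum_(d < 2) Xi a b d u * Xi c d e u
      - rho a b u * \sum_(d < 2) h c d * inv_metric x u e d) *: partial e x u
  + (partial c (rho a b) u + \sum_(d < 2) Xi a b d u * rho c d u)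
      *: gauss_map x u.
Proof.
move=> h.
have dX e := is_derive_scale _ _ (derivable_Xi a b e c)
  (derivable_partial hx _ e c Uu).
have dR := is_derive_scale _ _ (derivable_rho a b c) (derivable_gauss hx _ c Uu).
have D := is_deriveD (is_deriveD (dX 0) (dX 1)) dR.
have [_ E] := D.
have L : partial c (partial a (partial b x)) u = partial c (fun y =>
    Xi a b 0 y *: partial 0 x y + Xi a b 1 y *: partial 1 x y
    + rho a b y *: gauss_map x y) u.
  apply: (near_partial _ _ U u c (param_open hx) Uu) => y Uy.
  by rewrite (hXi _ Uy) sum_I2.
apply: etrans L _; apply: etrans E _.
rewrite -!/(partial _ _ _) (hXi _ Uu c 0) (hXi _ Uu c 1) (weingarten hx _ c Uu).
rewrite !sum_I2; exact: frame_collect.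
Qed.

End StructureEquations.

(** * The Gauss and Codazzi-Mainardi equations *)

Theorem mainTheorem8 (R : realType) (U : set 'rV[R]_2)
    (x : 'rV[R]_2 -> 'rV[R]_3)
    (Xi : 'I_2 -> 'I_2 -> 'I_2 -> 'rV[R]_2 -> R)
    (rho : 'I_2 -> 'I_2 -> 'rV[R]_2 -> R)
    (hx : admissible_param U x)
    (hXi : relative_connection x U Xi rho)
    (u : 'rV[R]_2) (hu : U u) (a b c e : 'I_2) :
  let h := second_fund x u in
  let ginv := inv_metric x u in
  let lam := enorm (gauss_map_tilde x u) ^+ 2 + gauss_map x u 0 2 in
  [/\ partial c (Xi a b e) u - partial b (Xi a c e) u
        + \sum_(d < 2) Xi a b d u * Xi c d e u
        - \sum_(d < 2) Xi a c d u * Xi b d e u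
      = \sum_(d < 2) (rho a b u * h c d - rho a c u * h b d) * ginv e d,
      \sum_(d < 2) (rho a b u * h c d - rho a c u * h b d) * ginv e d
      = \sum_(d < 2) (h a b * h c d - h a c * h b d) * (ginv e d / lam),
      \sum_(d < 2) (h a b * h c d - h a c * h b d) * (ginv e d / lam)
      = lam * \sum_(d < 2)
          (rho a b u * rho c d u - rho a c u * rho b d u) * ginv e d
    & partial c (rho a b) u - partial b (rho a c) u
        + \sum_(d < 2) Xi a b d u * rho c d u
        - \sum_(d < 2) Xi a c d u * rho b d u
      = 0].
Proof.
move=> h ginv lam.
have lamE : lam = normal_weight x u by [].
have lam0 : lam != 0 by rewrite lamE gt_eqF// normal_weight_gt0.
have hE i j : h i j = lam * rho i j u := second_fund_rho hx hXi hu i j.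
have T : partial c (partial a (partial b x)) u
       = partial b (partial a (partial c x)) u.
  exact: partial_comm3 (param_open hx) (param_smooth hx) hu.
rewrite (third_partial hx hXi hu) (third_partial hx hXi hu) in T.
(* Comparison of the components of the two expansions along x_e and xi. *)
have [/(_ e) tangential normal] := moving_frame_inj hx hu _ _ _ _ T.
have splitE (r1 r2 : R) (w1 w2 g : 'I_2 -> R) :
    \sum_(d < 2) (r1 * w1 d - r2 * w2 d) * g d =
    r1 * (\sum_(d < 2) w1 d * g d) - r2 * (\sum_(d < 2) w2 d * g d).
  by rewrite !sum_I2; ring.
have moveE (p1 p2 q1 q2 r1 r2 : R) :
    p1 + q1 - r1 = p2 + q2 - r2 -> p1 - p2 + q1 - q2 = r1 - r2.
  have -> : p1 - p2 + q1 - q2 = p1 + q1 - r1 - (p2 + q2 - r2) + (r1 - r2) by ring.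
  by move=> ->; rewrite subrr add0r.
split.
- rewrite (splitE _ _ (h c) (h b) (ginv e)).
  exact: moveE tangential.
- apply: eq_bigr => d _; rewrite !hE; by field.
- rewrite mulr_sumr; apply: eq_bigr => d _; rewrite !hE; by field.
- apply: etrans (moveE _ _ _ _ 0 0 _) (subrr 0).
  rewrite [LHS]subr0 [RHS]subr0; exact: normal.
Qed.
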